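(* For every $s$ with $1/2 \leq s < 2 - \sqrt{2}$ there exists a number $\sigma = \sigma(s) < s$ with the following property. For every constant $C \geq 1$ there exist constants $c > 0$ and $\delta_0 > 0$ such that the following holds for all $0 < \delta \leq \delta_0$. Let $A \subset [0,1]$ be a $(\delta,1/2)$-set with constant $C$ and with cardinality $C^{-1}\delta^{-1/2} \leq |A| \leq C\delta^{-1/2}$. Let $E \subset [0,1]$ be a set containing a finite subset $F \subset E$ such that $|F| \geq C^{-1}\delta^{-\sigma}$ and $|t - t'| \geq C^{-1}\delta^{s}$ for all distinct $t,t' \in F$. Then there exists $t \in E$ such that the set $A + tA$ contains at least $c\,\delta^{-s}$ points that are $\delta$-separated.
   Context: A set of real numbers is $\delta$-separated if any two distinct elements are at distance at least $\delta$. For $\delta > 0$, $u \geq 0$ and $C \geq 1$, a finite set $A \subset [0,1]$ is called a $(\delta,u)$-set with constant $C$ if $A$ is $\delta$-separated and $$|A \cap B(x,r)| \leq C\left(\frac{r}{\delta}\right)^{u} \quad \text{for all } x \in \mathbb{R} \text{ and } r \geq \delta.$$ Here $|\cdot|$ of a finite set denotes its cardinality, $B(x,r)$ is the ball (interval) of centre $x$ and radius $r$, and $A + tA := \{a + ta' : a,a' \in A\}$. The constants $C$ (in the hypotheses) and $c$ (in the conclusion) make explicit the notation $\lesssim, \gtrsim, \sim$, which means inequality (or two-sided inequality) up to a constant independent of $\delta$; the number $\sigma$ depends only on $s$. *)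

(* Defs.v *)
From HB Require Import structures.
From mathcomp Require Import all_boot all_order all_algebra finmap.
From mathcomp Require Import all_classical all_reals all_analysis.
Import Order.TTheory GRing.Theory Num.Theory.
Import numFieldNormedType.Exports.

Set Implicit Arguments.
Unset Strict Implicit.
Unset Printing Implicit Defensive.

Local Open Scope classical_set_scope.
Local Open Scope ring_scope.

Definition delta_separated (R : realType) (delta : R) (S : set R) : Prop :=
  forall x y : R, S x -> S y -> x != y -> delta <= `|x - y|.

(* [ball x r] is the open interval ]x - r, x + r[. As the bound is required
   for every r >= delta and its right-hand side is continuous in r, closed
   balls would give the same notion, with the same constant C. *)
Definition delta_u_set (R : realType) (delta u C : R) (A : {fset R}) : Prop :=
  [/\ [set` A] `<=` `[0, 1]%classic,
      delta_separated delta [set` A] &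
      forall x r : R, delta <= r ->
        (#|` [fset a in A | a \in (ball x r : set R)]%fset|)%:R
          <= C * (r / delta) `^ u].

Definition sum_dilate (R : realType) (A : {fset R}) (t : R) : {fset R} :=
  [fset (a + t * a')%R | a in A, a' in A]%fset.

(* Main.v *)
Require Import Defs.
From HB Require Import structures.
From mathcomp Require Import all_boot all_order all_algebra finmap.
From mathcomp Require Import all_classical all_reals all_analysis.
From mathcomp Require Import ring lra.
Import Order.TTheory GRing.Theory Num.Theory.
Import numFieldNormedType.Exports.

Set Implicit Arguments.
Unset Strict Implicit.
Unset Printing Implicit Defensive.

Local Open Scope classical_set_scope.
Local Open Scope ring_scope.

(** Why the theorem holds.  Since [2 - sqrt 2 < 3/5], only the bound
    [s <= 3/5] matters; the exponent is [sigma = s - 1/20].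

    Kaufman's energy argument applied to all of [A + tA] yields about [|F|]
    points that are [delta]-separated, hence only [delta^(-sigma)].  The missing
    factor [delta^(-1/20)] is gained by localising the second summand.  Let
    [r = delta^(1/10)] and let [B] be the part of [A] in an interval of radius
    [r] containing at least about [r |A|] points ([dense_ball]); the claim is
    proved for the smaller sets [A + tB].

    Let [P_t] be a maximal [delta]-separated subset of [A + tB].  Sending a pair
    [(a, b)] to a point of [P_t] near [a + tb], Cauchy-Schwarz gives
    [(|A||B|)^2 <= |P_t| E_t], where the energy [E_t] counts the quadruples
    [(a, b, a', b')] with [|(a + tb) - (a' + tb')| < 2 delta]
    ([card_le_net_energy]).  As [B] has diameter less than [2r], such a
    quadruple satisfies [|a - a'| < 4r], and so the number of admissible pairs
    [(a, a')] is at most [|A| C (4r / delta)^(1/2)], not [|A|^2].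

    The sum of [E_t] over [t] in [F] is split according to the size of
    [|b - b'|] ([sum_energy_le]).  If [|b - b'| >= delta^(1-s)], then the
    parameters [t] compatible with a quadruple lie in an interval of length
    [4 delta^s], which contains at most [5C] elements of [F].  If
    [|b - b'| < delta^(1-s)], there are few choices of [b'], and [t, a, b, b']
    determine [a'] up to [2C] choices.  Altogether
    [sum_t E_t <= 10 C^2 |A||B|^2 delta^(-9/20) + 2 C^2 |F||A||B| delta^(-s/2)].
    If every [P_t] had fewer than [c delta^(-s)] elements, multiplying by
    [c delta^(-s)] would bound [|F| (|A||B|)^2] by [14 C^4 c] times itself: for
    the first term because [sigma + 1/2 = s + 9/20], for the second because
    [3s/2 <= 9/10].  This is absurd for [c = 1 / (20 C^4)]. *)

(** * Finite sums and collisions *)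

Lemma sum_indicator (R : pzSemiRingType) (T : choiceType) (S : {fset T})
    (P : pred T) :
  \sum_(y <- S) (P y)%:R = (#|` [fset y in S | P y]%fset|)%:R :> R.
Proof.
rewrite -natr_sum; congr (_%:R).
rewrite card_fset_sum1 -big_fset_condE /= [RHS]big_mkcond.
by apply: eq_bigr => y _; case: (P y).
Qed.

Lemma sumr_const_fset (R : pzSemiRingType) (T : choiceType) (S : {fset T})
    (x : R) :
  \sum_(y <- S) x = (#|` S|)%:R * x.
Proof. by rewrite big_const_seq count_predT iter_addr_0 mulr_natl. Qed.

Lemma ler_sum_fset (R : numDomainType) (T : choiceType) (S : {fset T})
    (f g : T -> R) :
  (forall y, y \in S -> f y <= g y) -> \sum_(y <- S) f y <= \sum_(y <- S) g y.
Proof. by move=> h; rewrite big_seq [leRHS]big_seq; apply: ler_sum. Qed.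

Lemma sum_fset_le_card (R : numDomainType) (T : choiceType) (S : {fset T})
    (f : T -> R) (M : R) :
  (forall y, y \in S -> f y <= M) -> \sum_(y <- S) f y <= (#|` S|)%:R * M.
Proof. by move=> h; rewrite -sumr_const_fset; apply: ler_sum_fset. Qed.

(** Cauchy-Schwarz against the constant function. *)
Lemma sum_sqr_le (R : realFieldType) (T : choiceType) (S : {fset T})
    (f : T -> R) :
  (\sum_(y <- S) f y) ^+ 2 <= (#|` S|)%:R * \sum_(y <- S) f y ^+ 2.
Proof.
set m : R := (#|` S|)%:R; set s := \sum_(y <- S) f y.
have [m0|m0] := eqVneq m 0.
  have S0 : S = fset0.
    by apply/eqP; rewrite -cardfs_eq0 -(pnatr_eq0 R); apply/eqP.
  by rewrite /s S0 big_seq_fset0 m0 mul0r expr0n.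
have mp : 0 < m by rewrite lt_neqAle eq_sym m0 ler0n.
(* Up to a factor, the variance of [f] is nonnegative. *)
have : 0 <= \sum_(y <- S) (m * f y - s) ^+ 2.
  by apply: sumr_ge0 => y _; apply: sqr_ge0.
have -> : \sum_(y <- S) (m * f y - s) ^+ 2
   = m * (m * \sum_(y <- S) f y ^+ 2 - s ^+ 2).
  transitivity (\sum_(y <- S)
      (m ^+ 2 * f y ^+ 2 + (- (2 * m * s)) * f y + s ^+ 2)).
    by apply: eq_bigr => y _; ring.
  rewrite !big_split /= -!mulr_sumr sumr_const_fset -/m -/s; ring.
by rewrite pmulr_rge0 // subr_ge0.
Qed.

(** A map from [X] into a small set [P] has many collisions. *)
Lemma collision_count (R : realFieldType) (T : eqType) (U : choiceType)
    (X : seq T) (phi : T -> U) (P : {fset U}) :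
  (forall x, x \in X -> phi x \in P) ->
  (size X)%:R ^+ 2
    <= (#|` P|)%:R * \sum_(x <- X) \sum_(y <- X) (phi x == phi y)%:R :> R.
Proof.
move=> phiP.
have one x : x \in X -> \sum_(p <- P) (phi x == p)%:R = 1 :> R.
  move=> /phiP h; rewrite (big_fsetD1 (phi x)) //= eqxx.
  rewrite big_seq big1 ?addr0 // => p; rewrite !inE => /andP[].
  by rewrite eq_sym => /negbTE->.
have -> : (size X)%:R = \sum_(p <- P) \sum_(x <- X) (phi x == p)%:R :> R.
  rewrite exchange_big /= -sum1_size natr_sum big_seq [RHS]big_seq.
  by apply: eq_bigr => x xX; rewrite one.
apply: le_trans (sum_sqr_le _ _) _; rewrite ler_wpM2l //.
under eq_bigr do rewrite expr2 mulr_suml.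
rewrite exchange_big /= le_eqVlt; apply/orP; left; apply/eqP.
rewrite big_seq [RHS]big_seq; apply: eq_bigr => x xX.
under eq_bigr do rewrite mulr_sumr.
rewrite exchange_big /=; apply: eq_bigr => y _.
rewrite (big_fsetD1 (phi x)) ?phiP //= eqxx mul1r eq_sym.
rewrite big_seq big1 ?addr0 // => p; rewrite !inE => /andP[].
by rewrite eq_sym => /negbTE->; rewrite mul0r.
Qed.

(** * Separated sets *)

(** The number of points of [S] at distance less than [rho] from [x], as a real
    number.  Counts are written as sums of indicators, so that nested ones can
    be exchanged. *)
Definition near_count (R : realType) (S : {fset R}) (x rho : R) : R :=
  \sum_(y <- S) (`|y - x| < rho)%R%:R.

Lemma near_count_le (R : realType) (S : {fset R}) (x rho rho' : R) :
  rho <= rho' -> near_count S x rho <= near_count S x rho'.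
Proof.
move=> h; apply: ler_sum_fset => y _; rewrite ler_nat.
by case: (ltP `|y - x| rho) => // /lt_le_trans /(_ h) ->.
Qed.

Lemma near_count_subset (R : realType) (S S' : {fset R}) (x rho : R) :
  (S `<=` S')%fset -> near_count S x rho <= near_count S' x rho.
Proof.
move=> sub; rewrite /near_count !sum_indicator ler_nat fsubset_leq_card //.
apply/fsubsetP => y; rewrite !inE => /andP[yS ->]; rewrite andbT.
exact: (fsubsetP sub).
Qed.

(** A [d]-separated set has at most one point in each of the half-open cells
    of length [d] that cover an interval of length [L]. *)
Lemma card_delta_separated (R : realType) (d x L : R) (S : {fset R}) :
  0 < d -> 0 <= L -> delta_separated d [set` S] ->
  (forall y, y \in S -> x <= y <= x + L) -> (#|` S|)%:R <= L / d + 1.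
Proof.
move=> d0 L0 sep inS.
pose f y := Num.truncn ((y - x) / d).
have f0 y : y \in S -> 0 <= (y - x) / d.
  by move=> /inS/andP[h _]; rewrite divr_ge0 ?subr_ge0 // ltW.
have f_inj : {in S &, injective f}.
  move=> y z yS zS fyz; apply/eqP/negPn/negP => yz.
  have := sep _ _ yS zS yz; rewrite leNgt => /negP; apply.
  have /andP[y1 y2] := truncn_itv (f0 _ yS).
  have /andP[z1 z2] := truncn_itv (f0 _ zS).
  rewrite -/(f y) -/(f z) -fyz in y1 y2 z1 z2.
  have -> : y - z = ((y - x) / d - (z - x) / d) * d.
    by field; rewrite gt_eqF.
  rewrite normrM (gtr0_norm d0) -[ltRHS]mul1r ltr_pM2r //.
  rewrite ltr_norml; rewrite -natr1 in y2 z2; lra.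
have : (#|` [fset f y | y in S]%fset| <= (Num.truncn (L / d)).+1)%N.
  rewrite -[leqRHS](size_iota 0).
  apply: uniq_leq_size; first exact: fset_uniq.
  move=> n /imfsetP[y yS ->]; rewrite mem_iota leq0n add0n ltnS.
  rewrite truncn_le_nat; have /andP[_ yL] := inS _ yS.
  apply: le_lt_trans (truncnS_gt _).
  by rewrite ler_pM2r ?invr_gt0 // lerBlDl.
rewrite card_in_imfset // -(ler_nat R) => /le_trans; apply.
by rewrite -natr1 lerD2r truncn_le divr_ge0 // ltW.
Qed.

Lemma near_count_separated (R : realType) (d x rho : R) (S : {fset R}) :
  0 < d -> 0 <= rho -> delta_separated d [set` S] ->
  near_count S x rho <= 2 * rho / d + 1.
Proof.
move=> d0 r0 sep; rewrite /near_count sum_indicator.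
apply: (@card_delta_separated _ d (x - rho)) => //.
- by rewrite mulr_ge0.
- by move=> y z /=; rewrite !inE => /andP[yS _] /andP[zS _]; apply: sep.
- move=> y; rewrite !inE => /andP[_]; rewrite ltr_norml; lra.
Qed.

Lemma near_count_u_set (R : realType) (d u C : R) (A : {fset R}) (x rho : R) :
  delta_u_set d u C A -> d <= rho ->
  near_count A x rho <= C * (rho / d) `^ u.
Proof.
move=> [_ _ h] /(h x); rewrite /near_count sum_indicator.
congr (_ <= _); congr (#|` _|%:R).
apply/fsetP => y; rewrite !inE; congr (_ && _).
by rewrite distrC; apply/idP/idP; rewrite -ball_normE inE /=.
Qed.

(** Every finite set contains a [d]-separated [d]-net. *)
Lemma separated_net (R : realType) (d : R) (S : {fset R}) : 0 < d ->
  exists P : {fset R}, [/\ (P `<=` S)%fset, delta_separated d [set` P] &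
    forall x, x \in S -> exists2 p, p \in P & `|x - p| < d].
Proof.
move=> d0; elim/fset1U_rect: S => [|x S xS [P [PS sepP netP]]].
  by exists fset0; split=> // ?.
have [[p pP xp]|far] := pselect (exists2 p, p \in P & `|x - p| < d).
  exists P; split=> //; first exact: (fsubset_trans PS (fsubsetU1 _ _)).
  by move=> y; rewrite !inE => /orP[/eqP->|/netP//]; exists p.
have {}far p : p \in P -> d <= `|x - p|.
  by move=> pP; rewrite leNgt; apply/negP => xp; apply: far; exists p.
exists (x |` P)%fset; split; first exact: fsetUS.
- move=> y z /=; rewrite !inE => /orP[/eqP->|yP] /orP[/eqP->|zP].
  + by rewrite eqxx.
  + by move=> _; apply: far.
  + by move=> _; rewrite distrC; apply: far.
  + exact: sepP.
- move=> y; rewrite !inE => /orP[/eqP->|/netP[p pP yp]].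
    by exists x; rewrite ?inE ?eqxx // subrr normr0.
  by exists p => //; rewrite !inE pP orbT.
Qed.

(** Pigeonhole: the balls centred at a maximal [r]-separated subset, of which
    there are at most [2 / r], cover [A]. *)
Lemma dense_ball (R : realType) (r : R) (A : {fset R}) : 0 < r -> r <= 1 ->
  [set` A] `<=` `[0, 1]%classic ->
  exists x, (#|` A|)%:R * r / 2 <= near_count A x r.
Proof.
move=> r0 r1 A01; have [N [NA sepN netN]] := separated_net A r0.
have cN : (#|` N|)%:R <= 2 / r.
  apply: (@le_trans _ _ (1 / r + 1)).
    apply: (@card_delta_separated _ r 0) => // y /(fsubsetP NA) /A01.
    by rewrite /= in_itv /= add0r.
  rewrite (_ : 1 / r + 1 = (1 + r) / r); last by field; rewrite gt_eqF.
  by rewrite ler_pM2r ?invr_gt0 //; lra.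
apply: contrapT => /forallNP small.
have [A0|[a0 a0A]] := fset_0Vmem A.
  by apply: (small 0); rewrite A0 cardfs0 !mul0r; apply: sumr_ge0.
have : (#|` A|)%:R <= \sum_(x <- N) near_count A x r.
  rewrite exchange_big /= -[leLHS]mulr1 -sumr_const_fset.
  apply: ler_sum_fset => a aA; have [p pN ap] := netN _ aA.
  rewrite (big_fsetD1 p) //= ap lerDl; exact: sumr_ge0.
apply/negP; rewrite -ltNge.
have [n0 n0N _] := netN _ a0A.
apply: (@lt_le_trans _ _ (\sum_(x <- N) ((#|` A|)%:R * r / 2))); last first.
  rewrite sumr_const_fset.
  apply: (@le_trans _ _ (2 / r * ((#|` A|)%:R * r / 2))).
    by rewrite ler_wpM2r // divr_ge0 // mulr_ge0 // ltW.
  by rewrite le_eqVlt; apply/orP; left; apply/eqP; field; rewrite gt_eqF.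
rewrite (big_fsetD1 n0) //= [ltRHS](big_fsetD1 n0) //= ltr_leD //.
  by rewrite ltNge; apply/negP; apply: small.
by apply: ler_sum_fset => x _; rewrite leNgt; apply/negP => /ltW; apply: small.
Qed.

(** * The energy of A + tB *)

(** The number of quadruples [(a, b, a', b')], with [a, a'] in [A] and [b, b']
    in [B], for which [a + tb] and [a' + tb'] are at distance less than [rho]. *)
Definition energy (R : realType) (A B : {fset R}) (t rho : R) : R :=
  \sum_(a <- A) \sum_(b <- B) \sum_(a' <- A) \sum_(b' <- B)
    (`|(a + t * b) - (a' + t * b')| < rho)%R%:R.

(** If few points [P] suffice to approximate [A + tB] up to [d], then the energy
    is large. *)
Lemma card_le_net_energy (R : realType) (A B P : {fset R}) (t d : R) :
  (forall a b, a \in A -> b \in B ->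
     exists2 p, p \in P & `|(a + t * b) - p| < d) ->
  ((#|` A|)%:R * (#|` B|)%:R) ^+ 2 <= (#|` P|)%:R * energy A B t (2 * d).
Proof.
move=> net.
have near (x : R * R) : exists p, x.1 \in A -> x.2 \in B ->
    p \in P /\ `|(x.1 + t * x.2) - p| < d.
  have [xA|xA] := boolP (x.1 \in A); last by exists 0.
  have [xB|xB] := boolP (x.2 \in B); last by exists 0.
  by have [p pP xp] := net _ _ xA xB; exists p.
have [phi phiP] := choice near.
pose X := [seq (a, b) | a <- A, b <- B].
have inX a b : (a, b) \in X -> a \in A /\ b \in B.
  by move=> /allpairsP[[a' b'] /= [aA bB [-> ->]]].
have /(@collision_count R _ _ X) : forall x, x \in X -> phi x \in P.
  by move=> [a b] /inX[aA bB]; have [] := phiP (a, b) aA bB.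
rewrite size_allpairs natrM => /le_trans; apply.
rewrite ler_wpM2l // /X big_allpairs /energy.
apply: ler_sum_fset => a aA; apply: ler_sum_fset => b bB.
rewrite big_allpairs.
apply: ler_sum_fset => a' aA'; apply: ler_sum_fset => b' bB'.
rewrite ler_nat; have [e|//] := eqVneq.
have [_ h] := phiP (a, b) aA bB; have [_ h'] := phiP (a', b') aA' bB'.
rewrite -e in h'; rewrite (_ : _ < _) //; move: h h' => /=.
rewrite !ltr_norml; lra.
Qed.

(** Kaufman's energy estimate for a set [B] of diameter at most [2r].  Pairs in
    [B] at distance at least [eta] contribute the first term of the bound, the
    other pairs the second one.  The gain over the estimate for general [B] is
    that [M1] bounds the part of [A] in a short interval instead of [|A|]. *)
Lemma sum_energy_le (R : realType) (A B F : {fset R}) (d r eta K M1 M2 M3 : R) :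
  0 < eta -> 0 <= M3 -> d <= r ->
  (forall t, t \in F -> 0 <= t <= 1) ->
  (forall b b', b \in B -> b' \in B -> `|b' - b| < 2 * r) ->
  (forall x, near_count A x (4 * r) <= M1) ->
  (forall x, near_count B x eta <= M2) ->
  (forall x, near_count A x (2 * d) <= M3) ->
  (forall x, near_count F x (2 * d / eta) <= K) ->
  \sum_(t <- F) energy A B t (2 * d)
    <= K * M1 * (#|` A|)%:R * (#|` B|)%:R ^+ 2
       + (#|` F|)%:R * (#|` A|)%:R * (#|` B|)%:R * M2 * M3.
Proof.
move=> eta0 M30 dr F01 diamB cA1 cB cA3 cF.
pose I t a b a' b' : R := (`|(a + t * b) - (a' + t * b')| < 2 * d)%R%:R.
(* The quadruples counted by [I] are those of [G1], where [b] and [b'] are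
   distant and [a'] is confined to a short interval, and those of [G2]. *)
pose G1 t a b a' b' : R :=
  (`|a' - a| < 4 * r)%R%:R * ((eta <= `|b' - b|)%R%:R * I t a b a' b').
pose G2 t a b a' b' : R :=
  (`|b' - b| < eta)%R%:R * (`|a' - (a + t * (b - b'))| < 2 * d)%R%:R.
have split_I t a b a' b' : t \in F -> b \in B -> b' \in B ->
    I t a b a' b' <= G1 t a b a' b' + G2 t a b a' b'.
  move=> tF bB bB'; rewrite /G1 /G2 /I.
  have [h|_] := ltP `|_| (2 * d); last first.
    by rewrite !mulr0 add0r mulr_ge0.
  have -> : `|a' - (a + t * (b - b'))| = `|a + t * b - (a' + t * b')|.
    by rewrite distrC; congr (`|_|); ring.
  have -> : `|a' - a| < 4 * r.
    have /andP[t0 t1] := F01 _ tF.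
    (* Since [0 <= t <= 1], the small diameter of [B] forces [a'] near [a]. *)
    have tb : `|t * (b - b')| <= 2 * r.
      rewrite normrM -[leRHS]mul1r ler_pM //; first by rewrite ger0_norm.
      by rewrite ltW // diamB.
    rewrite (_ : a' - a = - (a + t * b - (a' + t * b')) + t * (b - b')).
      by apply: (le_lt_trans (ler_normD _ _)); rewrite normrN; lra.
    by ring.
  by rewrite h !mulr1 mul1r; case: ltP => _; rewrite ?addr0 ?add0r.
apply: (@le_trans _ _ (\sum_(t <- F) \sum_(a <- A) \sum_(b <- B)
   \sum_(a' <- A) \sum_(b' <- B) (G1 t a b a' b' + G2 t a b a' b'))).
  do 5 (apply: ler_sum_fset => ? ?); exact: split_I.
under eq_bigr do under eq_bigr do under eq_bigr do under eq_bigr do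
  rewrite big_split.
under eq_bigr do under eq_bigr do under eq_bigr do rewrite big_split.
under eq_bigr do under eq_bigr do rewrite big_split.
under eq_bigr do rewrite big_split.
rewrite big_split /=; apply: lerD.
- (* The sum over [t] is moved to the innermost position. *)
  rewrite exchange_big /=.
  rewrite [leRHS](_ : _ =
    (#|` A|)%:R * ((#|` B|)%:R * ((#|` B|)%:R * (M1 * K)))); last by ring.
  apply: sum_fset_le_card => a aA; rewrite exchange_big /=.
  apply: sum_fset_le_card => b bB; rewrite exchange_big /=.
  under eq_bigr do rewrite exchange_big /=.
  rewrite exchange_big /=.
  apply: sum_fset_le_card => b' bB'.
  have K0 : 0 <= K.
    by apply: le_trans (cF 0); apply: sumr_ge0.
  apply: (@le_trans _ _ (near_count A a (4 * r) * K)); last exact: ler_wpM2r.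
  rewrite mulr_suml; apply: ler_sum_fset => a' aA'.
  rewrite /G1 -mulr_sumr ler_wpM2l //.
  have [far|_] := leP eta `|b' - b|; last first.
    by rewrite big1 // => t _; rewrite mul0r.
  have v0 : 0 < `|b' - b| by exact: lt_le_trans far.
  have bb0 : b' - b != 0 by rewrite -normr_gt0.
  (* Here [t] must lie near the solution of [a + tb = a' + tb']. *)
  apply: le_trans (cF ((a - a') / (b' - b))).
  apply: ler_sum_fset => t tF; rewrite mul1r /I ler_nat.
  have [h|//] := ltP `|a + t * b - (a' + t * b')| (2 * d).
  rewrite (_ : `|_| < _) //.
  rewrite (_ : t - _ = - (a + t * b - (a' + t * b')) / (b' - b)); last by field.
  rewrite normrM normrN normfV.
  apply: (@lt_le_trans _ _ (2 * d / `|b' - b|)).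
    by rewrite ltr_pM2r ?invr_gt0.
  rewrite ler_wpM2l ?lef_pV2 //; apply: le_trans (ltW h); exact: normr_ge0.
- rewrite -!mulrA; apply: sum_fset_le_card => t tF.
  apply: sum_fset_le_card => a aA; apply: sum_fset_le_card => b bB.
  rewrite exchange_big /=.
  apply: (@le_trans _ _ (near_count B b eta * M3)); last exact: ler_wpM2r.
  rewrite mulr_suml; apply: ler_sum_fset => b' bB'.
  by rewrite /G2 -mulr_sumr ler_wpM2l //; exact: cA3.
Qed.

(** * The projection theorem *)

Lemma two_sub_sqrt2_le (R : realType) (s : R) :
  s < 2 - Num.sqrt 2 -> s <= 3 / 5.
Proof.
have : 7 / 5 <= Num.sqrt 2 :> R.
  rewrite -[leLHS]ger0_norm; last by lra.
  by rewrite -sqrtr_sqr ler_sqrt //; lra.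
lra.
Qed.

Theorem theorem1p6 (R : realType) (s : R)
    (hs1 : 1 / 2 <= s) (hs2 : s < 2 - Num.sqrt 2) :
  exists sigma : R, sigma < s /\
  forall C : R, 1 <= C ->
  exists c delta0 : R, [/\ 0 < c, 0 < delta0 &
  forall delta : R, 0 < delta -> delta <= delta0 ->
  forall A : {fset R},
    delta_u_set delta (1 / 2) C A ->
    C^-1 * delta `^ (- (1 / 2)) <= (#|` A|)%:R ->
    (#|` A|)%:R <= C * delta `^ (- (1 / 2)) ->
  forall E : set R, E `<=` `[0, 1]%classic ->
  forall F : {fset R}, [set` F] `<=` E ->
    C^-1 * delta `^ (- sigma) <= (#|` F|)%:R ->
    delta_separated (C^-1 * delta `^ s) [set` F] ->
  exists t : R, E t /\
  exists P : {fset R},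
    [/\ (P `<=` sum_dilate A t)%fset,
        delta_separated delta [set` P] &
        c * delta `^ (- s) <= (#|` P|)%:R]].
Proof.
have s35 := two_sub_sqrt2_le hs2.
exists (s - 1 / 20); split; first by lra.
move=> C C1; have C0 : 0 < C by lra.
exists (20 * C ^+ 4)^-1, 1; split=> //.
  by rewrite invr_gt0 mulr_gt0 // exprn_gt0.
move=> delta d0 d1 A uA lowA _ E E01 F FE lowF sepF.
set c := (20 * C ^+ 4)^-1; set D := delta `^ (- s).
apply: contrapT => /forallNP none.
have [A01 _ _] := uA.
set r := delta `^ (1 / 10).
have pw0 x : 0 < delta `^ x by exact: powR_gt0.
have pwD x y : delta `^ (x + y) = delta `^ x * delta `^ y.
  by rewrite powRD // (gt_eqF d0) implybT.
have pw1 : delta `^ 1 = delta by rewrite powRr1 // ltW.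
have pw_le x y : x <= y -> delta `^ y <= delta `^ x.
  by move=> xy; rewrite /powR (gt_eqF d0) ler_expR ler_wnM2r // ln_le0.
have pw_half x : (delta `^ x) `^ (1 / 2) = delta `^ (x / 2).
  by rewrite -powRrM mulrA mulr1.
have half4 : 4 `^ (1 / 2) = 2 :> R.
  rewrite mul1r powR12_sqrt // (_ : 4 = 2 ^+ 2) ?sqrtr_sqr ?ger0_norm //.
  by rewrite -natrX.
have dr : delta <= r by rewrite -[leLHS]pw1; apply: pw_le; lra.
have r0 : 0 < r by exact: pw0.
have r1 : r <= 1 by rewrite -[leRHS](powRr0 delta); apply: pw_le; lra.
have [x0 Bx0] := dense_ball r0 r1 A01.
set B := [fset a in A | `|a - x0| < r]%fset.
have BA : (B `<=` A)%fset by apply/fsubsetP => y; rewrite !inE => /andP[].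
have {Bx0}lowB : (#|` A|)%:R * r / 2 <= (#|` B|)%:R.
  by move: Bx0; rewrite /near_count sum_indicator.
have F01 t : t \in F -> 0 <= t <= 1.
  by move=> /FE /E01; rewrite /= in_itv.
set eta := delta `^ (1 - s).
have deta : delta <= eta by rewrite -[leLHS]pw1; apply: pw_le; lra.
have eta0 : 0 < eta by exact: pw0.
have pw_ratio k x : 0 <= k -> (k * delta `^ x / delta) `^ (1 / 2)
    = k `^ (1 / 2) * delta `^ ((x - 1) / 2).
  move=> k0; rewrite -pw_half pwD powRN pw1 -mulrA [LHS]powRM //.
  by rewrite mulr_ge0 ?invr_ge0 // ltW.
have cA1 x : near_count A x (4 * r) <= 2 * C * delta `^ (- (9 / 20)).
  apply: le_trans (near_count_u_set x uA _) _; first by lra.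
  rewrite pw_ratio // half4 (_ : (1 / 10 - 1) / 2 = - (9 / 20)); last by field.
  by rewrite mulrCA mulrA.
have cB x : near_count B x eta <= C * delta `^ (- (s / 2)).
  apply: le_trans (near_count_subset _ _ BA) _.
  apply: le_trans (near_count_u_set x uA deta) _.
  rewrite -[eta]mul1r pw_ratio // powR1 mul1r.
  by rewrite (_ : (1 - s - 1) / 2 = - (s / 2)) //; field.
have cA3 x : near_count A x (2 * delta) <= 2 * C.
  (* Enlarging the radius to [4 delta] makes the square root rational. *)
  have d24 : 2 * delta <= 4 * delta by lra.
  apply: le_trans (near_count_le _ _ d24) _.
  apply: le_trans (near_count_u_set x uA _) _; first by lra.
  by rewrite mulfK ?gt_eqF // half4 mulrC.
have cF x : near_count F x (2 * delta / eta) <= 5 * C.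
  apply: le_trans (near_count_separated x _ _ sepF) _.
  - by rewrite mulr_gt0 ?invr_gt0.
  - by rewrite divr_ge0 ?mulr_ge0 // ltW.
  have -> : 2 * (2 * delta / eta) / (C^-1 * delta `^ s) = 4 * C.
    have e : eta * delta `^ s = delta by rewrite -pwD subrK.
    rewrite -{1}e; field.
    by rewrite !gt_eqF.
  by lra.
have diamB b b' : b \in B -> b' \in B -> `|b' - b| < 2 * r.
  by rewrite !inE => /andP[_] + /andP[_]; rewrite !ltr_norml; lra.
have M30 : 0 <= 2 * C by lra.
have bound := sum_energy_le eta0 M30 dr F01 diamB cA1 cB cA3 cF.
set a : R := (#|` A|)%:R in lowA lowB bound.
set b : R := (#|` B|)%:R in lowB bound.
set f : R := (#|` F|)%:R in lowF bound.
have a0 : 0 < a by apply: lt_le_trans lowA; rewrite mulr_gt0 ?invr_gt0.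
have f0 : 0 < f by apply: lt_le_trans lowF; rewrite mulr_gt0 ?invr_gt0.
have b0 : 0 < b by apply: lt_le_trans lowB; rewrite divr_gt0 ?mulr_gt0.
have c0 : 0 < c by rewrite invr_gt0 mulr_gt0 // exprn_gt0.
have energy_ge0 t : 0 <= energy A B t (2 * delta).
  by do 4 (apply: sumr_ge0 => ? _).
have small t : t \in F -> (a * b) ^+ 2 <= c * D * energy A B t (2 * delta).
  move=> tF.
  have [P [PS sepP netP]] :=
    separated_net [fset (u + t * v)%R | u in A, v in B]%fset d0.
  apply: le_trans (@card_le_net_energy _ A B P t delta _) _.
    by move=> u v uA' vB; apply: netP; apply/imfset2P; exists u => //; exists v.
  rewrite ler_wpM2r // leNgt; apply/negP => big.
  apply: (none t); split; first exact: FE.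
  exists P; split=> //; last exact: ltW.
  apply: fsubset_trans PS _; apply/fsubsetP => y /imfset2P[u uA' [v vB ->]].
  apply/imfset2P; exists u => //; exists v => //; exact: (fsubsetP BA).
have cD0 : 0 <= c * D by rewrite mulr_ge0 ?(ltW c0) ?(ltW (pw0 _)).
have {small} main : f * (a * b) ^+ 2 <= c * D *
    (5 * C * (2 * C * delta `^ (- (9 / 20))) * a * b ^+ 2
     + f * a * b * (C * delta `^ (- (s / 2))) * (2 * C)).
  apply: le_trans (ler_wpM2l cD0 bound).
  rewrite mulr_sumr -(sumr_const_fset F).
  by apply: ler_sum_fset => t tF; exact: small.
(* The term of distant pairs, where [- s - 9/20 = - sigma - 1/2]. *)
have e1 : D * delta `^ (- (9 / 20)) <= C ^+ 2 * (f * a).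
  have lowf : delta `^ (- (s - 1 / 20)) <= C * f.
    by rewrite -ler_pdivrMl.
  have lowa : delta `^ (- (1 / 2)) <= C * a by rewrite -ler_pdivrMl.
  rewrite -pwD (_ : - s + - (9 / 20) = - (s - 1 / 20) + - (1 / 2)); last by field.
  rewrite pwD (_ : C ^+ 2 * (f * a) = (C * f) * (C * a)); last by ring.
  by apply: ler_pM => //; apply: ltW.
(* The term of close pairs, where [- 3s/2 >= - 9/10 = - 1/2 - 1/2 + 1/10]. *)
have e2 : D * delta `^ (- (s / 2)) <= 2 * C ^+ 2 * (a * b).
  have lowa : delta `^ (- (1 / 2)) <= C * a by rewrite -ler_pdivrMl.
  apply: (@le_trans _ _ (C * a * (C * a) * r)); last first.
    rewrite (_ : C * a * (C * a) * r = 2 * C ^+ 2 * (a * (a * r / 2)));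
      last by field.
    have C20 : 0 <= 2 * C ^+ 2 by rewrite mulr_ge0 // sqr_ge0.
    by rewrite ler_wpM2l // ler_wpM2l // ltW.
  apply: (@le_trans _ _ (delta `^ (- (1 / 2)) * delta `^ (- (1 / 2)) * r)).
    by rewrite -!pwD; apply: pw_le; lra.
  rewrite ler_wpM2r ?(ltW r0) //.
  by apply: ler_pM => //; apply: ltW.
have : f * (a * b) ^+ 2 <= 14 / 20 * (f * (a * b) ^+ 2).
  apply: le_trans main _.
  rewrite (_ : c * D * _ = c * (10 * C ^+ 2 * (a * b ^+ 2)
      * (D * delta `^ (- (9 / 20)))
    + 2 * C ^+ 2 * (f * a * b) * (D * delta `^ (- (s / 2))))); last by ring.
  rewrite [leRHS](_ : _ = c * (10 * C ^+ 2 * (a * b ^+ 2)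
      * (C ^+ 2 * (f * a))
    + 2 * C ^+ 2 * (f * a * b) * (2 * C ^+ 2 * (a * b)))); last first.
    by rewrite /c; field; rewrite gt_eqF.
  rewrite ler_wpM2l ?(ltW c0) // lerD // ler_wpM2l //;
    by rewrite !mulr_ge0 ?sqr_ge0 // ltW.
have : 0 < f * (a * b) ^+ 2 by rewrite mulr_gt0 // exprn_gt0 // mulr_gt0.
lra.
Qed.
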